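(* There are absolute constants $c_0,c>0$ such that for every $0<\varepsilon\le c_0$ and every triangle-free graph $G=([n],E)$ with $m$ edges, the output $S$ of the following algorithm satisfies $\mathbb E[\mathrm{val}_G(S)]\ge(\frac12+c\,\varepsilon)\mathrm{OPT}_G$. Algorithm: set $d=10000/\varepsilon^2$; for each $v$ let $\hat d(v)=d(v)+\mathrm{Lap}(3/\varepsilon)$ and $\mathcal C=\{v:\hat d(v)>d\}$; let $G_1=(\mathcal C,E_1)$ with $E_1$ the edges of $G$ with both endpoints in $\mathcal C$; sample $S_1^A\in\{\pm1\}^{\mathcal C}$ with $\Pr[S_1^A=\hat S]\propto\exp(\varepsilon\,\mathrm{val}_{G_1}(\hat S)/6)$; let $S_1^B$ be uniform in $\{\pm1\}^{[n]\setminus\mathcal C}$ and $S_1$ the concatenation; let $S_2$ be the output of $\mathcal A_{\varepsilon/3}$ on $G$; output $S_1$ or $S_2$ with probability $1/2$ each. Here $\mathcal A_{\varepsilon'}$: set $\varepsilon_0=\varepsilon'/2$, choose independent uniform $c_1(v),c_2(v)\in\{\pm1\}$, let $\ell(v)=|\{u:\{u,v\}\in E,c_1(u)=c_1(v)\}|$, sample independent $\zeta_v\sim\mathrm{DLap}(1/\varepsilon_0)$, set $c(v)=c_1(v)$ if $\ell(v)-\lceil\frac{d(v)-1}2\rceil+\zeta_v\le0$, else $c(v)=c_2(v)$, and output $c$.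
   Context: $G$ is a simple undirected graph; $d(v)$ its degree. A cut is an assignment in $\{\pm1\}^V$; $\mathrm{val}_H(S)$ is the number of edges of $H$ whose endpoints receive different values, and $\mathrm{OPT}_G$ is the maximum cut size of $G$. $\mathrm{Lap}(b)$ has density $\frac1{2b}e^{-|x|/b}$; $\mathrm{DLap}(1/\varepsilon_0)$ has mass $\frac{e^{\varepsilon_0}-1}{e^{\varepsilon_0}+1}e^{-\varepsilon_0|x|}$ at $x\in\mathbb Z$. *)

(* Defs.v *)
From HB Require Import structures.
From mathcomp Require Import all_boot all_order all_algebra.
From mathcomp Require Import all_classical all_reals all_analysis.
Set Implicit Arguments. Unset Strict Implicit. Unset Printing Implicit Defensive.
Import Order.TTheory GRing.Theory Num.Theory.
Local Open Scope classical_set_scope.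
Local Open Scope ring_scope.

Section Graphs.
Variable n : nat.
Implicit Types (e : rel 'I_n) (S : {ffun 'I_n -> bool}) (C : {set 'I_n}).

Definition simple_graph e := symmetric e /\ irreflexive e.
Definition triangle_free e := forall u v w : 'I_n, e u v -> e v w -> e u w -> False.

Definition deg e (v : 'I_n) : nat := #|[set u | e v u]|.

(* a cut is S : {±1}^V, encoded as a boolean function; val_H(S) = number of edges
   {u,v} (counted once, via u < v) whose endpoints get different values *)
Definition val e S : nat :=
  #|[set p : 'I_n * 'I_n | [&& (p.1 < p.2)%N, e p.1 p.2 & S p.1 != S p.2]]|.
Definition OPT e : nat := \max_(S : {ffun 'I_n -> bool}) val e S.

(* val_{G_1}(S) where G_1 = (C, E_1), E_1 = edges of G with both endpoints in C;
   it only depends on S restricted to C *)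
Definition valIn e C S : nat :=
  #|[set p : 'I_n * 'I_n | [&& (p.1 < p.2)%N, p.1 \in C, p.2 \in C,
                              e p.1 p.2 & S p.1 != S p.2]]|.

Variable R : realType.

Definition lap_tail (b a : R) : R :=
  fine (\int[lebesgue_measure]_(x in `]a, +oo[%classic)
          ((2 * b)^-1 * expR (- `|x| / b))%:E)%E.

Definition dlap_mass (eps0 : R) (z : int) : R :=
  (expR eps0 - 1) / (expR eps0 + 1) * expR (- eps0 * (`|z|%:~R)).

Definition ell e (c1 : {ffun 'I_n -> bool}) (v : 'I_n) : nat :=
  #|[set u | e u v && (c1 u == c1 v)]|.

Definition thr e (v : 'I_n) : int := Num.ceil ((((deg e v)%:R - 1) / 2) : R).

Definition keep_prob (eps0 : R) e c1 (v : 'I_n) : R :=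
  fine (\esum_(z in [set z : int | ((ell e c1 v)%:Z - thr e v + z <= 0)%R])
          (dlap_mass eps0 z)%:E)%E.

(* E[val_G(output of A_{eps'})]: c1, c2 uniform and independent, and the zeta_v
   independent, so given c1, c2 the coordinates c(v) are independent with
   c(v) = c1(v) w.p. keep_prob and c(v) = c2(v) otherwise *)
Definition expected_A (eps' : R) e : R :=
  let eps0 := eps' / 2 in
  \sum_(c1 : {ffun 'I_n -> bool}) \sum_(c2 : {ffun 'I_n -> bool})
    ((2 ^+ n)^-1 * (2 ^+ n)^-1) *
    \sum_(c : {ffun 'I_n -> bool})
      (\prod_(v : 'I_n)
          ((c v == c1 v)%:R * keep_prob eps0 e c1 v
           + (c v == c2 v)%:R * (1 - keep_prob eps0 e c1 v)))
      * (val e c)%:R.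

Definition inC_prob (eps : R) e (v : 'I_n) : R :=
  lap_tail (3 / eps) (10000 / eps ^+ 2 - (deg e v)%:R).

Definition probC (eps : R) e C : R :=
  \prod_(v in C) inC_prob eps e v * \prod_(v in ~: C) (1 - inC_prob eps e v).

(* normalizing constant of the exponential mechanism on {±1}^C; an element of
   {±1}^C is represented by a full cut which is fixed (= false) outside C *)
Definition Zexp (eps : R) e C : R :=
  \sum_(T : {ffun 'I_n -> bool} | [forall v in ~: C, T v == false])
     expR (eps * (valIn e C T)%:R / 6).

(* Pr[S_1 = S | C] = Pr[S_1^A = S|_C] * Pr[S_1^B = S|_{[n]\C}] *)
Definition probS1 (eps : R) e C S : R :=
  expR (eps * (valIn e C S)%:R / 6) / Zexp eps e C * (2 ^+ (n - #|C|))^-1.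

Definition expected_S1 (eps : R) e : R :=
  \sum_(C : {set 'I_n}) probC eps e C *
    \sum_(S : {ffun 'I_n -> bool}) probS1 eps e C S * (val e S)%:R.

Definition expected_output (eps : R) e : R :=
  2^-1 * expected_S1 eps e + 2^-1 * expected_A (eps / 3) e.

End Graphs.

(* Main.v *)
(* In the local algorithm, averaging over c2 makes the output spins independent
   given c1, with means keep_prob * c1. For an edge uv of a triangle-free graph
   the two keep probabilities are independent given c1 u and c1 v, and each is a
   decreasing function of the agreement of the endpoints, so uv is cut with
   probability at least 1/2; when an endpoint has degree O(1/eps^2), the noise of
   scale 1/eps is not smaller than the fluctuations of ell and the gain is of order eps.
   For the exponential mechanism on C, the edges leaving C are cut with
   probability exactly 1/2, while the expected value inside C is at least both
   half of the edges inside C and the optimum inside C minus 6 k / eps, where k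
   is the number of non-isolated vertices of C. Averaging these two bounds gains
   a quarter of the edges inside C, up to 3 k / eps. In expectation over C, this
   covers the edges with both endpoints of high degree, and k is at most
   eps * m / 500. Weighting the second gain by a multiple of eps, the two gains
   together are of order eps * m. *)

Require Import Defs.
From HB Require Import structures.
From mathcomp Require Import all_boot all_order all_algebra.
From mathcomp Require Import all_classical all_reals all_analysis.
From mathcomp Require Import measurable_realfun.
From mathcomp Require Import ring lra zify.
Set Implicit Arguments. Unset Strict Implicit. Unset Printing Implicit Defensive.
Import Order.TTheory GRing.Theory Num.Theory.
Import numFieldNormedType.Exports.
Local Open Scope ring_scope.

(** * Tails of the continuous Laplace distribution *)

Section Laplace.
Local Open Scope classical_set_scope.
Variables (R : realType) (b : R).
Hypothesis b_gt0 : 0 < b.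
Local Notation mu := (@lebesgue_measure R).
Let f (x : R) : R := (2 * b)^-1 * expR (- `|x| / b).

Let f_ge0 x : 0 <= f x.
Proof. by rewrite mulr_ge0 ?expR_ge0// invr_ge0 mulr_ge0// ltW. Qed.

Let cexp : continuous (fun x : R => expR (- x / b)).
Proof.
move=> x; apply: continuous_comp; last exact: continuous_expR.
by apply: cvgMr_tmp; apply: cvgN; exact: cvg_id.
Qed.

Let cf : continuous f.
Proof.
move=> x; apply: cvgMl_tmp.
apply: (@continuous_comp R R R (fun x => `|x|) (fun x => expR (- x / b))).
  exact: norm_continuous.
exact: cexp.
Qed.

Let mf (D : set R) : measurable D -> measurable_fun D (EFin \o f).
Proof.
move=> mD; apply/measurable_EFinP; apply: measurable_funTS.
exact: continuous_measurable_fun.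
Qed.

Lemma lap_integral_ge0 (a : R) : 0 <= a ->
  (\int[mu]_(x in `]a, +oo[) (f x)%:E = (2^-1 * expR (- a / b))%:E)%E.
Proof.
move=> a_ge0.
have f1 x : a <= x -> f x = (2 * b)^-1 * expR (- x / b).
  by move=> ax; rewrite /f ger0_norm// (le_trans a_ge0).
rewrite integral_itv_obnd_cbnd//; last exact: mf.
have dF x : is_derive x (1:R) (fun x => - (2^-1 * expR (- x / b)))
                        ((2 * b)^-1 * expR (- x / b)).
  apply: is_derive_eq.
  rewrite /GRing.scale/=.
  by field; rewrite ?gt_eqF.
rewrite (@ge0_continuous_FTC2y _ f (fun x => - (2^-1 * expR (- x / b))) _ 0)//.
- by rewrite EFinN oppeK add0e.
- by apply: continuous_subspaceT.
- rewrite -oppr0; apply: cvgN; rewrite -(mulr0 2^-1); apply: cvgMl_tmp.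
  rewrite (_ : (fun x => expR (- x / b)) =
               (fun z => expR (- z)) \o (fun z => b^-1 * z)); last first.
    by apply: eq_fun => x; rewrite mulNr mulrC.
  apply: (@cvg_comp _ _ _ _ _ _ (pinfty_nbhs R)); last exact: cvgr_expR.
  by apply: gt0_cvgMry; rewrite ?invr_gt0//; exact: cvg_id.
- by apply: cvg_at_right_filter; apply: cvgN; apply: cvgMl_tmp; exact: cexp.
- move=> x; rewrite in_itv/= andbT => ax.
  by rewrite derive1E derive_val f1// ltW.
Qed.

Lemma lap_tailE (a : R) : 0 <= a -> lap_tail b a = 2^-1 * expR (- a / b).
Proof. by move=> a0; rewrite /lap_tail lap_integral_ge0. Qed.

(** The density is even, so the whole line has twice the mass 1/2 of the positive half-line. This
    also makes the tail integrals finite, so that [fine] loses nothing. *)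
Let integral_le1 (a : R) :
  (\int[mu]_(x in `]a, +oo[) (f x)%:E <= 1%:E)%E.
Proof.
apply: (@le_trans _ _ (\int[mu]_x (f x)%:E)%E).
  apply: ge0_subset_integral => //; [exact: mf|by move=> x _; rewrite lee_fin].
rewrite ge0_symfun_integralT//; last by move=> x; rewrite /f /= normrN.
rewrite -set_itvcy -integral_itv_obnd_cbnd ?lap_integral_ge0//; last exact: mf.
by rewrite oppr0 mul0r expR0 -EFinM lee_fin; lra.
Qed.

Let fin_lap (a : R) : (\int[mu]_(x in `]a, +oo[) (f x)%:E)%E \is a fin_num.
Proof.
rewrite ge0_fin_numE; first by rewrite (le_lt_trans (integral_le1 a)) ?ltry.
by apply: integral_ge0 => x _; rewrite lee_fin.
Qed.

Lemma lap_tail_ge0 (a : R) : 0 <= lap_tail b a.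
Proof. by apply: fine_ge0; apply: integral_ge0 => x _; rewrite lee_fin f_ge0. Qed.

Lemma lap_tail_le1 (a : R) : lap_tail b a <= 1.
Proof.
have := integral_le1 a.
by rewrite -(fineK (fin_lap a)) lee_fin.
Qed.

Lemma lap_tail_ge_half (a : R) : a <= 0 -> 2^-1 <= lap_tail b a.
Proof.
move=> a0; have <- : lap_tail b 0 = 2^-1.
  by rewrite lap_tailE// oppr0 mul0r expR0 mulr1.
apply: fine_le; [exact: fin_lap|exact: fin_lap|].
apply: ge0_subset_integral => //; first exact: mf.
  by move=> x _; exact: f_ge0.
by move=> x/=; rewrite !in_itv/= !andbT; apply: le_lt_trans.
Qed.

End Laplace.

(** * The discrete Laplace distribution function and its increments *)

Section DiscreteLaplace.
Local Open Scope classical_set_scope.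
Variables (R : realType) (eps0 : R).
Hypothesis eps0_gt0 : 0 < eps0.
Let f (z : int) : \bar R := (dlap_mass eps0 z)%:E.

Lemma dlap_mass_ge0 (z : int) : 0 <= dlap_mass eps0 z.
Proof.
apply: mulr_ge0; last exact: expR_ge0.
apply: divr_ge0; last by rewrite addr_ge0 ?expR_ge0.
by rewrite subr_ge0 -expR0 ler_expR ltW.
Qed.

Let f_ge0 z : (0 <= f z)%E.
Proof. by rewrite lee_fin dlap_mass_ge0. Qed.

Definition dlap_cdf (j : int) : R :=
  fine (\esum_(z in [set z : int | (z <= j)%R]) f z)%E.

Let esum_step (j : int) :
  (\esum_(z in [set z : int | (z <= j)%R]) f z =
   \esum_(z in [set z : int | (z <= j - 1)%R]) f z + f j)%E.
Proof.
rewrite [LHS](@esumID R int [set j] _ f); last by move=> z _; exact: f_ge0.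
rewrite addeC; congr (_ + _)%E.
  congr esum; apply/seteqP; split => z /=.
    by move=> [zj /eqP zNj]; lia.
  by move=> zj; split; [lia|move=> zE; lia].
rewrite (_ : _ `&` _ = [set j]) ?esum_set1//.
by apply/seteqP; split=> z /=; [case|move=> ->].
Qed.

(** Indexing the nonpositive integers by [- k] turns the sum into a geometric series of ratio
    [(expR eps0)^-1]. *)
Lemma dlap_cdf_esum0 :
  (\esum_(z in [set z : int | (z <= 0)%R]) f z = (expR eps0 / (expR eps0 + 1))%:E)%E.
Proof.
rewrite (@reindex_esum _ _ _ [set: nat] _ (fun k => - k%:Z)); last first.
  split => //.
  - by move=> k _ /=; lia.
  - by move=> k l _ _ /=; lia.
  - by move=> z /= z0; exists `|z|%N => //; lia.
rewrite -nneseries_esumT//.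
have x1 : 1 < expR eps0 by rewrite -expR0 ltr_expR.
set x := expR eps0 in x1 *.
have := @cvg_geometric_series R ((x - 1) / (x + 1)) (x^-1).
have -> : `|x^-1| < 1 by rewrite ger0_norm ?invr_ge0 ?invf_lt1//; lra.
move=> /(_ isT) /(cvg_comp _ _) H.
apply/cvg_lim => //.
rewrite (_ : (fun n => _) = EFin \o series (geometric ((x - 1) / (x + 1)) (x^-1))).
  rewrite (_ : x / (x + 1) = (x - 1) / (x + 1) * (1 - x^-1)^-1); last first.
    by field; rewrite !gt_eqF//; lra.
  by apply: H; exact: cvg_refl.
apply/funext => k /=; rewrite -sumEFin /series/=.
apply: eq_bigr => i _; rewrite /f /dlap_mass -/x normrN.
by rewrite mulNr expRN exprVn -expRM_natl [eps0 * _]mulrC.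
Qed.

(** Finiteness spreads upwards from the explicit value at 0, one mass at a time; a general [j] is
    dominated by its absolute value. *)
Let esum_fin (j : int) :
  (\esum_(z in [set z : int | (z <= j)%R]) f z)%E \is a fin_num.
Proof.
have finP (k : nat) : (\esum_(z in [set z : int | (z <= k%:Z)%R]) f z < +oo)%E.
  elim: k => [|k IHk]; first by rewrite dlap_cdf_esum0 ltry.
  rewrite esum_step (_ : k.+1%:Z - 1 = k%:Z); last by lia.
  by apply: lte_add_pinfty; [exact: IHk|exact: ltry].
rewrite ge0_fin_numE; last by apply: esum_ge0 => z _.
apply: le_lt_trans (finP `|j|%N).
rewrite -(setIidl (_ : [set z : int | z <= j] `<=` [set z | z <= `|j|%N%:Z])).
  rewrite esum_mkcondl; apply: le_esum => z _.
  by case: ifP.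
by move=> z /=; lia.
Qed.

Lemma dlap_cdf_ge0 (j : int) : 0 <= dlap_cdf j.
Proof. by apply: fine_ge0; apply: esum_ge0 => z _. Qed.

Lemma dlap_cdfB (j : int) : dlap_cdf j - dlap_cdf (j - 1) = dlap_mass eps0 j.
Proof.
rewrite /dlap_cdf esum_step fineD ?esum_fin//=.
by rewrite addrAC subrr add0r.
Qed.

Lemma dlap_cdf_ge_half (j : int) : 0 <= j -> 2^-1 <= dlap_cdf j.
Proof.
have cdf0 : 2^-1 <= dlap_cdf 0.
  rewrite /dlap_cdf dlap_cdf_esum0/= -(ler_pM2r (_ : 0 < expR eps0 + 1)).
    have x1 : 1 < expR eps0 by rewrite -expR0 ltr_expR.
    by rewrite mulfVK; [lra|rewrite gt_eqF//; lra].
  by rewrite addr_gt0 ?expR_gt0.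
case: j => // k _; elim: k => [//|k IHk].
have := dlap_cdfB k.+1; have := dlap_mass_ge0 k.+1.
rewrite (_ : k.+1%:Z - 1 = k%:Z); last by lia.
by lra.
Qed.

(** The prefactor increases with [expR eps0 >= 1 + eps0], hence is at least
    [eps0 / (2 + eps0) >= eps0 / 3]. *)
Lemma dlap_mass_ge (z : int) :
  eps0 <= 1 -> eps0 / 3 * expR (- (eps0 * `|z|%:~R)) <= dlap_mass eps0 z.
Proof.
move=> eps0_le1; rewrite /dlap_mass mulNr; apply: ler_wpM2r; first exact: expR_ge0.
have e0 := eps0_gt0.
have x1 : 1 + eps0 <= expR eps0 by exact: expR_ge1Dx.
rewrite ler_pdivlMr; last by lra.
by nra.
Qed.

End DiscreteLaplace.

Lemma keep_probE (n : nat) (R : realType) (eps0 : R) (e : rel 'I_n) c1 v :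
  keep_prob eps0 e c1 v = dlap_cdf eps0 (thr R e v - (ell e c1 v)%:Z).
Proof.
rewrite /keep_prob /dlap_cdf; congr (fine (esum _ _)).
by apply/seteqP; split=> z /=; lia.
Qed.

(** * Averages over a uniform cut *)

Section UniformCut.
Variables (n : nat) (R : realType).
Notation cut := {ffun 'I_n -> bool}.
Implicit Types (F G : cut -> R) (A B : {set 'I_n}) (c : cut).

Definition avg F : R := (2 ^+ n)^-1 * \sum_c F c.

Lemma eq_avg F G : F =1 G -> avg F = avg G.
Proof. by move=> FG; congr (_ * _); apply: eq_bigr. Qed.

Lemma avgD F G : avg (fun c => F c + G c) = avg F + avg G.
Proof. by rewrite /avg big_split mulrDr. Qed.

Lemma avgZ (k : R) F : avg (fun c => k * F c) = k * avg F.
Proof. by rewrite /avg -mulr_sumr mulrCA. Qed.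

Lemma avgB F G : avg (fun c => F c - G c) = avg F - avg G.
Proof. by rewrite /avg sumrB mulrBr. Qed.

Lemma avg_sum (I : finType) (P : pred I) (F : I -> cut -> R) :
  avg (fun c => \sum_(i | P i) F i c) = \sum_(i | P i) avg (F i).
Proof. by rewrite /avg exchange_big mulr_sumr. Qed.

Lemma avg_cst (k : R) : avg (fun=> k) = k.
Proof.
rewrite /avg sumr_const card_ffun card_bool card_ord -[k *+ _]mulr_natr natrX.
by rewrite mulrC mulfK// expf_neq0.
Qed.

Lemma ler_avg F G : (forall c, F c <= G c) -> avg F <= avg G.
Proof.
by move=> FG; rewrite ler_wpM2l ?invr_ge0 ?exprn_ge0// ler_sum.
Qed.

(** A measure-preserving involution; the symmetry arguments below are changes of variable along
    it. *)
Definition flip A c : cut := [ffun v => c v (+) (v \in A)].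

Lemma flipK A : involutive (flip A).
Proof. by move=> c; apply/ffunP=> v; rewrite !ffunE -addbA addbb addbF. Qed.

Lemma sum_flip A F : \sum_c F (flip A c) = \sum_c F c.
Proof. by rewrite [RHS](reindex_inj (inv_inj (flipK A))). Qed.

Lemma avg_flip A F : avg (fun c => F (flip A c)) = avg F.
Proof. by rewrite /avg sum_flip. Qed.

Definition depends_on A F := forall c c', {in A, c =1 c'} -> F c = F c'.

Lemma depends_onS A B F : A \subset B -> depends_on A F -> depends_on B F.
Proof. by move=> /fintype.subsetP AB dF c c' cc'; apply: dF => v /AB/cc'. Qed.

(* Swapping the A-parts of two independent cuts c, c' is a bijection on pairs. *)
Lemma avg_indep A B F G : [disjoint A & B] -> depends_on A F -> depends_on B G ->
  avg (fun c => F c * G c) = avg F * avg G.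
Proof.
move=> /pred0P AB dF dG.
pose mix c c' : cut := [ffun v => if v \in A then c v else c' v].
have FE c c' : F (mix c c') = F c by apply: dF => v vA; rewrite ffunE vA.
have GE c c' : G (mix c c') = G c'.
  by apply: dG => v vB; rewrite ffunE; have /= := AB v; rewrite vB andbT => ->.
suff : \sum_(p : cut * cut) F p.1 * G p.2 = \sum_(p : cut * cut) F p.1 * G p.1.
  rewrite -(pair_bigA _ (fun c c' => F c * G c')) /=.
  rewrite -(pair_bigA _ (fun c c' => F c * G c)) /=.
  under eq_bigr do rewrite -mulr_sumr.
  rewrite -mulr_suml.
  under [X in _ = X]eq_bigr do rewrite sumr_const card_ffun card_bool card_ord.
  rewrite sumrMnl -[_ *+ (2 ^ n)]mulr_natr natrX => H.
  rewrite /avg mulrACA H; field.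
  by rewrite expf_neq0.
rewrite [RHS](reindex_inj (inv_inj (_ : involutive
  (fun p : cut * cut => (mix p.1 p.2, mix p.2 p.1))))).
  by apply: eq_bigr => -[c c'] _ /=; rewrite FE GE.
by move=> [c c']; congr (_, _); apply/ffunP => v; rewrite !ffunE; case: (v \in A).
Qed.

Lemma sum_prod_cut (h : 'I_n -> bool -> R) :
  \sum_(c : cut) \prod_v h v (c v) = \prod_v (h v true + h v false).
Proof.
by rewrite -bigA_distr_bigA; apply: eq_bigr => v _; rewrite big_bool.
Qed.

Lemma avg_prod_cut (h : 'I_n -> bool -> R) :
  avg (fun c => \prod_v h v (c v)) = \prod_v ((h v true + h v false) / 2).
Proof.
by rewrite /avg sum_prod_cut big_split/= prodr_const card_ord exprVn mulrC.
Qed.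

Lemma avg_spin (u : 'I_n) (s : bool) : avg (fun c => (c u == s)%:R) = 2^-1.
Proof.
have flipE c : (c u == s)%:R + (flip [set u] c u == s)%:R = 1 :> R.
  by rewrite ffunE inE eqxx; case: (c u) s => -[]; rewrite /= ?addr0 ?add0r.
have := avg_flip [set u] (fun c => (c u == s)%:R).
have := avgD (fun c => (c u == s)%:R) (fun c => (flip [set u] c u == s)%:R).
by rewrite (eq_avg flipE) avg_cst; lra.
Qed.

Definition sgn (b : bool) : R := (-1) ^+ b.

Lemma neq_sgn (a b : bool) : (a != b)%:R = (1 - sgn a * sgn b) / 2.
Proof. by case: a b => -[]; rewrite /sgn /= ?expr0 ?expr1; field. Qed.

Lemma prod_if (u : 'I_n) (f : 'I_n -> R) :
  \prod_w (if w == u then f w else 1) = f u.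
Proof. by rewrite -big_mkcond big_pred1_eq. Qed.

(* Averaged over c2, the output spins are independent with means q * c1. *)
Lemma mixture_cut_prob (q : 'I_n -> R) (c1 : cut) (u v : 'I_n) : u != v ->
  avg (fun c2 => \sum_(c : cut)
    (\prod_w ((c w == c1 w)%:R * q w + (c w == c2 w)%:R * (1 - q w)))
    * (c u != c v)%:R)
  = (1 - q u * q v * (sgn (c1 u) * sgn (c1 v))) / 2.
Proof.
move=> uv; rewrite avg_sum.
(* The law of the output spin at [w] once [c2] is averaged out: [c1 w] with weight [q w], a fair
   coin with weight [1 - q w]. *)
pose h w b : R := (b == c1 w)%:R * q w + (1 - q w) / 2.
transitivity (\sum_(c : cut) (\prod_w h w (c w)) * (c u != c v)%:R).
  apply: eq_bigr => c _.
  under eq_avg do rewrite mulrC.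
  rewrite avgZ mulrC; congr (_ * _).
  rewrite (avg_prod_cut (fun w b => (c w == c1 w)%:R * q w + (c w == b)%:R * (1 - q w))).
  apply: eq_bigr => w _; rewrite /h.
  by case: (c w) => /=; field.
(* Inserting the spins of [u] and [v] into the factors keeps the correlation a product over
   vertices. *)
pose k w b := h w b * ((if w == u then sgn b else 1) * (if w == v then sgn b else 1)).
have -> : \sum_(c : cut) (\prod_w h w (c w)) * (c u != c v)%:R =
  (\sum_(c : cut) (\prod_w h w (c w)) - \sum_(c : cut) (\prod_w k w (c w))) / 2.
  rewrite -sumrB mulr_suml; apply: eq_bigr => c _.
  rewrite neq_sgn /k !big_split/= (prod_if u (fun w => sgn (c w))).
  by rewrite (prod_if v (fun w => sgn (c w))); field.
congr ((_ - _) / 2).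
  rewrite sum_prod_cut; apply: big1 => w _; rewrite /h.
  by case: (c1 w) => /=; field.
rewrite sum_prod_cut.
transitivity (\prod_w ((if w == u then q w * sgn (c1 w) else 1)
                     * (if w == v then q w * sgn (c1 w) else 1))).
  apply: eq_bigr => w _; rewrite /k /h.
  have [->|wu] := eqVneq w u.
    rewrite (negbTE uv); rewrite /sgn.
    by case: (c1 u) => /=; rewrite ?expr0 ?expr1; field.
  by case: (w == v); rewrite /sgn; case: (c1 w) => /=; rewrite ?expr0 ?expr1; field.
rewrite big_split/= (prod_if u (fun w => q w * sgn (c1 w))).
by rewrite (prod_if v (fun w => q w * sgn (c1 w))); ring.
Qed.

Definition count_in A c : nat := #|[set w in A | c w]|.

Lemma count_in_flip A c : (count_in A c + count_in A (flip [set: 'I_n] c) = #|A|)%N.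
Proof.
rewrite /count_in -(cardsID [set w | c w] A); congr (_ + _)%N.
  by apply: eq_card => w; rewrite !inE.
by apply: eq_card => w; rewrite !inE ffunE inE addbT andbC.
Qed.

(** For distinct vertices, flipping [u] alone negates the product. *)
Lemma avg_sgn2 (u v : 'I_n) : avg (fun c => sgn (c u) * sgn (c v)) = (u == v)%:R.
Proof.
have [->|uv] := eqVneq u v.
  rewrite (eq_avg (_ : _ =1 fun=> 1)) ?avg_cst// => c.
  by rewrite /sgn -expr2 sqrr_sign.
have := avg_flip [set u] (fun c => sgn (c u) * sgn (c v)).
rewrite (eq_avg (_ : _ =1 (fun c => -1 * (sgn (c u) * sgn (c v))))).
  by rewrite avgZ /=; lra.
move=> c; rewrite !ffunE !inE eqxx eq_sym (negbTE uv) addbT addbF /sgn.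
by case: (c u) => /=; rewrite ?expr0 ?expr1; ring.
Qed.

(** Up to sign, the quantity squared is the sum of the spins over [A]; only the diagonal of its
    square survives averaging. *)
Lemma avg_count_in_var A :
  avg (fun c => (2 * (count_in A c)%:R - #|A|%:R) ^+ 2) = #|A|%:R.
Proof.
have E c : (2 * (count_in A c)%:R - #|A|%:R) ^+ 2 =
    \sum_(u in A) \sum_(v in A) sgn (c u) * sgn (c v).
  have -> : 2 * (count_in A c)%:R - #|A|%:R = - \sum_(u in A) sgn (c u).
    rewrite /count_in -!sum1_card.
    rewrite (eq_bigl (fun w => (w \in A) && c w)); last by move=> w; rewrite inE.
    rewrite big_mkcondr/= !natr_sum mulr_sumr -sumrB -sumrN.
    by apply: eq_bigr => w _; rewrite /sgn; case: (c w); rewrite /= ?expr0 ?expr1; ring.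
  rewrite sqrrN expr2 mulr_suml; apply: eq_bigr => u _.
  by rewrite mulr_sumr.
rewrite (eq_avg E) avg_sum -sum1_card natr_sum; apply: eq_bigr => u uA.
rewrite avg_sum (bigD1 u)//= avg_sgn2 eqxx big1 ?addr0// => v /andP[_ vu].
by rewrite avg_sgn2 eq_sym (negbTE vu).
Qed.

End UniformCut.

(** * Keep probabilities averaged over the spins of a neighbourhood *)

Section NeighbourAverage.
Variables (n : nat) (R : realType).
Notation cut := {ffun 'I_n -> bool}.
Implicit Types (N : {set 'I_n}) (c : cut) (K : int -> R).

(* For N the neighbours of u other than v, and k = 1 or 0 according to whether
   u and v have the same spin, this is the conditional mean of keep_prob at u. *)
Definition nbr_avg K N (t : int) (k : nat) : R :=
  avg (fun c => K (t - (k + count_in N c)%N%:Z)).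

(** The global flip exchanges the two spins, so the average is the same whichever spin the centre
    has. *)
Lemma nbr_avg_spin K N t k (s : bool) :
  avg (fun c => K (t - (k + #|[set w in N | c w == s]|)%N%:Z)) = nbr_avg K N t k.
Proof.
case: s.
  by apply: eq_avg => c; rewrite /count_in; under eq_finset do rewrite eqb_id.
rewrite /nbr_avg -[RHS](avg_flip [set: 'I_n]); apply: eq_avg => c.
rewrite /count_in; congr (K (t - (k + _)%N%:Z)); apply: eq_card => w.
by rewrite !inE ffunE inE addbT eqbF_neg.
Qed.

Lemma nbr_avg_ge0 K N t k : (forall j, 0 <= K j) -> 0 <= nbr_avg K N t k.
Proof. by move=> K0; rewrite -(avg_cst n (0 : R)); apply: ler_avg => c. Qed.

(* One of a cut and its negation has at most half of its ones in N. *)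
Lemma nbr_avg_ge_quarter K N (t : int) :
  (forall j, 0 <= K j) -> (forall j, 0 <= j -> 2^-1 <= K j) ->
  #|N|%:R / 2 <= t%:~R :> R -> 4^-1 <= nbr_avg K N t 0.
Proof.
move=> K0 K2 Nt.
have flipE := avg_flip [set: 'I_n] (fun c => K (t - (0 + count_in N c)%N%:Z)).
have : avg (fun _ : cut => 2^-1 : R) <= nbr_avg K N t 0 + nbr_avg K N t 0.
  rewrite -[X in _ + X]flipE /nbr_avg -avgD.
  apply: ler_avg => c.
  rewrite !add0n; have := count_in_flip N c.
  set B := count_in _ _; set B' := count_in _ _ => BB'.
  have NE : (#|N|%:Z)%:~R <= (2 * t)%:~R :> R.
    by rewrite intrM -[2%:~R]/(2 : R) -[(#|N|%:Z)%:~R]/(#|N|%:R); lra.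
  move: NE; rewrite ler_int -BB' => NE.
  have [|] := leP (B%:Z) t => Bt.
    have K2B : 2^-1 <= K (t - B%:Z) by apply: K2; lia.
    by have := K0 (t - B'%:Z); lra.
  have K2B : 2^-1 <= K (t - B'%:Z) by apply: K2; lia.
  by have := K0 (t - B%:Z); lra.
by rewrite avg_cst; lra.
Qed.

Variables (eps0 : R).
Hypothesis eps0_gt0 : 0 < eps0.
Notation K := (dlap_cdf eps0).

(** One more agreement moves the argument of the distribution function down by one, which costs a
    single point mass. *)
Lemma nbr_avg_dlapB N (t : int) :
  nbr_avg K N t 0 - nbr_avg K N t 1 =
  avg (fun c => dlap_mass eps0 (t - (count_in N c)%:Z)).
Proof.
rewrite /nbr_avg -avgB; apply: eq_avg => c.
rewrite -dlap_cdfB//; congr (K _ - K _); lia.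
Qed.

Lemma nbr_avg_dlap_le N (t : int) : nbr_avg K N t 1 <= nbr_avg K N t 0.
Proof.
rewrite -subr_ge0 nbr_avg_dlapB -(avg_cst n (0 : R)); apply: ler_avg => c.
exact: dlap_mass_ge0.
Qed.

(* The slope is the average of the Laplace mass, which is bounded below by the
   tangent of expR at -100 and the variance of count_in. *)
Lemma nbr_avg_dlap_gap N (t : int) :
  #|N|%:R / 2 <= t%:~R :> R -> t%:~R <= #|N|%:R / 2 + 1 :> R ->
  eps0 <= 1 -> eps0 ^+ 2 * #|N|%:R <= 300 ->
  eps0 / 3 * expR (- 100) <= nbr_avg K N t 0 - nbr_avg K N t 1.
Proof.
move=> tN Nt e1 epsN; have e0 := eps0_gt0.
rewrite nbr_avg_dlapB.
pose Y c : R := 2 * (count_in N c)%:R - #|N|%:R.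
(* An upper bound for [eps0] times the distance from [t] to [count_in N c]: that distance is at most
   [1 + |Y c| / 2], and [2 * y <= y ^+ 2 + 1] is used at [y = eps0 * |Y c|]. *)
pose x c : R := eps0 + (eps0 ^+ 2 * Y c ^+ 2 + 1) / 4.
(* As [Y] has variance [#|N|], the average is at most [1 + 1 / 4 + 300 / 4]. *)
have avgx : avg x <= 100.
  rewrite /x (eq_avg (_ : _ =1
    fun c => (eps0 + 4^-1) + eps0 ^+ 2 / 4 * Y c ^+ 2)).
    by rewrite avgD avg_cst avgZ avg_count_in_var; lra.
  by move=> c; field.
apply: (@le_trans _ _ (avg (fun c => eps0 / 3 * expR (- 100) * (101 - x c)))).
  rewrite avgZ avgB avg_cst ler_peMr//; last by lra.
  by apply: mulr_ge0; [lra|exact: expR_ge0].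
apply: ler_avg => c.
apply: le_trans (dlap_mass_ge _ _ e1) => //.
rewrite -mulrA; apply: ler_wpM2l; first by lra.
have xE : eps0 * `|t - (count_in N c)%:Z|%:~R <= x c.
  have absE : `|t - (count_in N c)%:Z|%:~R <= 1 + `|Y c| / 2.
    rewrite intr_norm intrB.
    have -> : t%:~R - (count_in N c)%:Z%:~R = (t%:~R - #|N|%:R / 2) - Y c / 2 :> R.
      by rewrite /Y -[((count_in N c)%:Z)%:~R]/((count_in N c)%:R); field.
    apply: le_trans (ler_normB _ _) _; apply: lerD.
      by rewrite ger0_norm; lra.
    by rewrite normrM [ `|2^-1| ]ger0_norm.
  have YE : `|Y c| ^+ 2 = Y c ^+ 2 by rewrite real_normK ?num_real.
  have := ler_wpM2l (ltW e0) absE.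
  have := sqr_ge0 (eps0 * `|Y c| - 1).
  rewrite /x -YE; move: (`|Y c|) => y; nra.
apply: (@le_trans _ _ (expR (- x c))); last by rewrite ler_expR lerN2.
have -> : - x c = - 100 + (100 - x c) by ring.
rewrite expRD; apply: ler_wpM2l; first exact: expR_ge0.
by apply: le_trans (expR_ge1Dx _); lra.
Qed.

End NeighbourAverage.

(** * From classical sets to finite sets *)

Section FinsetForms.
Variables (n : nat) (e : rel 'I_n).

(* The sets in the definitions of deg, val, valIn and ell are classical sets. *)
Lemma card_mkset (T : finType) (P : pred T) :
  #|[set x | P x]%classic| = #|[set x | P x]|.
Proof.
apply: eq_card => x; rewrite [RHS]inE.
by apply/idP/idP => [/set_mem|Px]; last exact/mem_set.
Qed.

Lemma degE v : deg e v = #|[set u | e v u]|.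
Proof. exact: card_mkset. Qed.

Lemma ellE (c : {ffun 'I_n -> bool}) v :
  ell e c v = #|[set u | e u v && (c u == c v)]|.
Proof. exact: card_mkset. Qed.

End FinsetForms.

(** * Correlation of the kept spins across an edge *)

Section EdgeCorrelation.
Variables (n : nat) (R : realType) (e : rel 'I_n) (eps0 : R).
Notation cut := {ffun 'I_n -> bool}.
Hypotheses (simple_e : simple_graph e) (triangle_free_e : triangle_free e).
Notation K := (dlap_cdf eps0).

Definition nbrs (u v : 'I_n) : {set 'I_n} := [set w | e w u & w != v].

Lemma card_nbrs u v : e u v -> deg e u = (#|nbrs u v|).+1.
Proof.
have [sym_e _] := simple_e.
move=> uv; rewrite degE (cardsD1 v) inE uv add1n; congr _.+1.
by apply: eq_card => w; rewrite !inE andbC sym_e.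
Qed.

Lemma ell_nbrs u v (c : cut) : e u v ->
  ell e c u = ((c v == c u) + #|[set w in nbrs u v | c w == c u]|)%N.
Proof.
have [sym_e _] := simple_e.
move=> uv; rewrite ellE (cardsD1 v) inE sym_e uv; congr (_ + _)%N.
by apply: eq_card => w; rewrite !inE; case: (w != v); rewrite ?andbT ?andbF.
Qed.

(** Given the spins of [u] and [v], the two keep probabilities depend on disjoint sets of other
    vertices, so their means multiply. Equal spins, of probability 1/2, give the term with argument
    1 and sign plus; opposite spins give the other term. *)
Lemma edge_correlation u v : e u v ->
  avg (fun c => keep_prob eps0 e c u * keep_prob eps0 e c v *
                (sgn R (c u) * sgn R (c v))) =
  2^-1 * (nbr_avg K (nbrs u v) (thr R e u) 1 * nbr_avg K (nbrs v u) (thr R e v) 1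
        - nbr_avg K (nbrs u v) (thr R e u) 0 * nbr_avg K (nbrs v u) (thr R e v) 0).
Proof.
have [sym_e irr_e] := simple_e.
move=> uv; have vu : e v u by rewrite sym_e.
have uNv : u != v by apply: contraTneq uv => ->; rewrite irr_e.
(* The keep probability of [u] when its spin is [s] and [k] records whether [v] agrees; it reads
   only the spins on [nbrs u v]. *)
pose Q (u v : 'I_n) (s : bool) (k : nat) (c : cut) :=
  K (thr R e u - (k + #|[set w in nbrs u v | c w == s]|)%N%:Z).
have QE c : keep_prob eps0 e c u * keep_prob eps0 e c v *
    (sgn R (c u) * sgn R (c v)) =
    \sum_s \sum_t (sgn R s * sgn R t) * ((c u == s)%:R *
      ((c v == t)%:R * (Q u v s (s == t) c * Q v u t (s == t) c))).
  rewrite !keep_probE (ell_nbrs _ uv) (ell_nbrs _ vu) [c u == c v]eq_sym.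
  by rewrite !big_bool /Q; case: (c u); case: (c v) => /=; ring.
have dQ u' v' s k : depends_on (nbrs u' v') (Q u' v' s k).
  move=> c c' cc'; rewrite /Q; congr (K (_ - (_ + _)%N%:Z)).
  by apply: eq_card => w; rewrite !inE; apply: andb_id2l => wN; rewrite cc' ?inE.
have dspin w s : depends_on [set w] (fun c : cut => (c w == s)%:R : R).
  by move=> c c' cc'; rewrite cc' ?inE.
have dM A F G : depends_on A F -> depends_on A G ->
    depends_on A (fun c : cut => F c * G c : R).
  by move=> dF dG c c' cc'; rewrite (dF _ _ cc') (dG _ _ cc').
rewrite (eq_avg QE) avg_sum.
under eq_bigr do rewrite avg_sum.
have E s t : avg (fun c => (sgn R s * sgn R t) * ((c u == s)%:R *
      ((c v == t)%:R * (Q u v s (s == t) c * Q v u t (s == t) c)))) =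
    (sgn R s * sgn R t) * (2^-1 * (2^-1 *
      (nbr_avg K (nbrs u v) (thr R e u) (s == t)
       * nbr_avg K (nbrs v u) (thr R e v) (s == t)))).
  rewrite avgZ; congr (_ * _).
  (* A common neighbour would close a triangle. *)
  have NN : [disjoint nbrs u v & nbrs v u].
    apply/pred0P => w /=; apply/negbTE; rewrite !inE.
    apply/negP => /andP[/andP[wu _] /andP[wv _]].
    by apply: (triangle_free_e uv _ _) => //; rewrite sym_e; eassumption.
  have dQv : depends_on (~: [set u; v]) (fun c => Q u v s (s == t) c * Q v u t (s == t) c).
    apply: dM; apply: depends_onS (dQ _ _ _ _);
      apply/fintype.subsetP => w; rewrite !inE negb_or => /andP[ew wN];
      rewrite wN ?andbT /=; apply: contraTneq ew => ->; by rewrite irr_e.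
  (* Independence is used three times: to split off the spin of [u], then that of [v], then to
     separate the two neighbourhoods. *)
  rewrite (@avg_indep _ _ [set u] (~: [set u])) //.
  - rewrite avg_spin; congr (_ * _).
    rewrite (@avg_indep _ _ [set v] (~: [set u; v])) //.
    + rewrite avg_spin; congr (_ * _).
      rewrite (@avg_indep _ _ (nbrs u v) (nbrs v u)) //.
      by rewrite /Q !nbr_avg_spin.
    + by apply/pred0P => w /=; rewrite !inE; case: (w == v); rewrite ?orbT ?andbF.
  - by apply/pred0P => w /=; rewrite !inE andbN.
  - apply: dM.
      apply: depends_onS (dspin v t); apply/fintype.subsetP => w.
      by rewrite !inE => /eqP->; rewrite eq_sym.
    apply: depends_onS dQv; apply/fintype.subsetP => w.
    by rewrite !inE negb_or => /andP[].
under eq_bigr do (under eq_bigr do rewrite E).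
by rewrite !big_bool/= /sgn !expr0 !expr1; field.
Qed.

Lemma thr_nbrs u v : e u v ->
  #|nbrs u v|%:R / 2 <= (thr R e u)%:~R :> R /\
  (thr R e u)%:~R <= #|nbrs u v|%:R / 2 + 1 :> R.
Proof.
move=> uv; rewrite /thr (card_nbrs uv) -(natr1 #|nbrs u v|) addrK.
have /andP[] := ceil_itv (#|nbrs u v|%:R / 2 : R).
by rewrite intrB => lt1 ->; lra.
Qed.

End EdgeCorrelation.

(** * Edge sums and the handshake identity *)

Section Edges.
Variables (n : nat) (R : realType) (e : rel 'I_n).
Notation cut := {ffun 'I_n -> bool}.

Definition edges : {set 'I_n * 'I_n} :=
  [set p : 'I_n * 'I_n | (p.1 < p.2)%N && e p.1 p.2].

Lemma valE (S : cut) :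
  (Defs.val e S)%:R = \sum_(p in edges) (S p.1 != S p.2)%:R :> R.
Proof.
rewrite /Defs.val card_mkset -sum1_card natr_sum big_mkcond [RHS]big_mkcond.
apply: eq_bigr => p _; rewrite !inE andbA.
by case: ((p.1 < p.2)%N && e p.1 p.2); case: (S p.1 != S p.2).
Qed.

Lemma edges_neq (p : 'I_n * 'I_n) : p \in edges -> p.1 != p.2.
Proof. by rewrite inE => /andP[pp _]; apply: contraTneq pp => ->; rewrite ltnn. Qed.

(** The ordered adjacent pairs split into the increasing ones and their transposes. *)
Lemma sum_deg : symmetric e -> irreflexive e ->
  (\sum_v deg e v = 2 * #|edges|)%N.
Proof.
move=> sym_e irr_e.
transitivity (\sum_(v : 'I_n) \sum_(u : 'I_n) (e v u : nat))%N.
  apply: eq_bigr => v _; rewrite degE -sum1_card big_mkcond.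
  by apply: eq_bigr => u _; rewrite inE.
have edgesE : #|edges| = (\sum_(v : 'I_n) \sum_(u : 'I_n) ((v < u)%N && e v u : nat))%N.
  rewrite pair_bigA -sum1_card big_mkcond; apply: eq_bigr => -[v u] _.
  by rewrite inE; case: (_ && _).
rewrite mul2n -addnn {2}edgesE [in RHS]exchange_big edgesE -big_split /=.
apply: eq_bigr => v _; rewrite -big_split /=; apply: eq_bigr => u _.
rewrite [e u v]sym_e; case: (ltngtP v u) => [||/val_inj ->].
- by case: (e v u).
- by case: (e v u).
- by rewrite irr_e.
Qed.

End Edges.

(** * The gain of the local algorithm *)

Section LocalAlgorithm.
Variables (n : nat) (R : realType) (e : rel 'I_n).
Notation cut := {ffun 'I_n -> bool}.
Hypotheses (simple_e : simple_graph e) (triangle_free_e : triangle_free e).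

Lemma expected_A_edges (eps' : R) : expected_A eps' e =
  \sum_(p in edges e) avg (fun c =>
    (1 - keep_prob (eps' / 2) e c p.1 * keep_prob (eps' / 2) e c p.2
         * (sgn R (c p.1) * sgn R (c p.2))) / 2).
Proof.
rewrite -avg_sum /avg mulr_sumr; apply: eq_bigr => c1 _.
under eq_bigr do rewrite -mulrA.
rewrite -mulr_sumr; congr (_ * _).
set q := keep_prob (eps' / 2) e c1.
transitivity (avg (fun c2 : cut => \sum_(p in edges e) \sum_(c : cut)
    (\prod_w ((c w == c1 w)%:R * q w + (c w == c2 w)%:R * (1 - q w)))
    * (c p.1 != c p.2)%:R)).
  rewrite /avg mulr_sumr; apply: eq_bigr => c2 _; congr (_ * _).
  rewrite exchange_big; apply: eq_bigr => c _.
  by rewrite valE mulr_sumr.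
rewrite avg_sum; apply: eq_bigr => p pE.
by rewrite mixture_cut_prob ?(edges_neq pE).
Qed.

Variable eps : R.
Hypotheses (eps_gt0 : 0 < eps) (eps_le1 : eps <= 1).

(** The threshold of the algorithm applied to the true degree: a deterministic stand-in for
    membership in the random set. *)
Definition high (v : 'I_n) : bool := 10000 / eps ^+ 2 < (deg e v)%:R.
Definition high_edges : {set 'I_n * 'I_n} :=
  [set p in edges e | high p.1 && high p.2].

(** With [a0], [a1] the averages at [u] and [b0], [b1] those at [v], the correlation is half of
    [a1 * b1 - a0 * b0], at most half of [- b0 * (a0 - a1)]. Here [b0 >= 1/4], and a low degree of
    [u] makes [a0 - a1] at least [eps / 18 * expR (- 100)]. *)
Lemma edge_gap u v : e u v ->
  let X := avg (fun c => keep_prob (eps / 3 / 2) e c u *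
    keep_prob (eps / 3 / 2) e c v * (sgn R (c u) * sgn R (c v))) in
  X <= 0 /\ (~~ high u -> X <= - (eps * expR (- 100) / 144)).
Proof.
have e0 := eps_gt0; have e1 := eps_le1; have [sym_e irr_e] := simple_e.
move=> uv; have vu : e v u by rewrite sym_e.
have h0 : 0 < eps / 3 / 2 by lra.
have h1 : eps / 3 / 2 <= 1 by lra.
have [ul uh] := thr_nbrs R simple_e uv; have [vl vh] := thr_nbrs R simple_e vu.
rewrite edge_correlation//.
have cdf_ge0 := dlap_cdf_ge0 h0; have cdf_half := dlap_cdf_ge_half h0.
have v0 := nbr_avg_ge_quarter cdf_ge0 cdf_half vl.
have u0 := nbr_avg_ge_quarter cdf_ge0 cdf_half ul.
have v1 := nbr_avg_ge0 (nbrs e v u) (thr R e v) 1 cdf_ge0.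
have u1 := nbr_avg_ge0 (nbrs e u v) (thr R e u) 1 cdf_ge0.
have v10 := nbr_avg_dlap_le h0 (nbrs e v u) (thr R e v).
have u10 := nbr_avg_dlap_le h0 (nbrs e u v) (thr R e u).
have gap : ~~ high u -> eps / 3 / 2 / 3 * expR (- 100) <=
    nbr_avg (dlap_cdf (eps / 3 / 2)) (nbrs e u v) (thr R e u) 0 -
    nbr_avg (dlap_cdf (eps / 3 / 2)) (nbrs e u v) (thr R e u) 1.
  rewrite /high -leNgt => ulow; apply: nbr_avg_dlap_gap => //.
  (* The noise parameter is [eps / 6], and [10000 / 36] is below the bound 300 required for the
     gap. *)
  have : (deg e u)%:R * eps ^+ 2 <= 10000 by rewrite -ler_pdivlMr ?exprn_gt0.
  rewrite (card_nbrs simple_e uv) -(natr1 #|nbrs e u v|).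
  by have := sqr_ge0 eps; have : 0 <= #|nbrs e u v|%:R :> R by []; nra.
have E0 := expR_ge0 (- 100 : R).
move: gap u0 v0 u1 v1 u10 v10 E0.
move: (nbr_avg _ _ _ 0) (nbr_avg _ _ _ 0) (nbr_avg _ _ _ 1) (nbr_avg _ _ _ 1).
move=> b0 a0 b1 a1 gap u0 v0 u1 v1 u10 v10; move: (expR _) gap => E gap E0.
have M1 : a1 * b1 <= a1 * b0 by rewrite ler_wpM2l.
have M2 : a1 * b0 <= a0 * b0 by rewrite ler_wpM2r//; lra.
split=> [|/gap {}gap]; first by lra.
have : 4^-1 * (a0 - a1) <= b0 * (a0 - a1) by rewrite ler_wpM2r// subr_ge0.
have -> : b0 * (a0 - a1) = a0 * b0 - a1 * b0 by ring.
have -> : eps * E / 144 = 2^-1 * (4^-1 * (eps / 3 / 2 / 3 * E)) by field.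
by lra.
Qed.

(** An edge is cut with probability half of one minus its correlation. [edge_gap] looks at the
    degree of the first endpoint only, so it is applied in both orientations. *)
Lemma expected_A_ge :
  #|edges e|%:R / 2 + eps * expR (- 100) / 288 * (#|edges e|%:R - #|high_edges|%:R)
  <= expected_A (eps / 3) e.
Proof.
have e0 := eps_gt0; have [sym_e _] := simple_e.
have E0 := expR_ge0 (- 100 : R).
have -> : #|high_edges|%:R = \sum_(p in edges e) (high p.1 && high p.2)%:R :> R.
  rewrite -sum1_card natr_sum big_mkcond [RHS]big_mkcond; apply: eq_bigr => p _.
  by rewrite [p \in high_edges]inE; case: (p \in edges e); case: (high p.1 && _).
rewrite -sum1_card natr_sum mulr_suml -sumrB mulr_sumr -big_split.
rewrite expected_A_edges; apply: ler_sum => p; rewrite inE => /andP[_ pE].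
have pE' : e p.2 p.1 by rewrite sym_e.
rewrite (eq_avg (_ : _ =1 (fun c => 2^-1 - 2^-1 *
   (keep_prob (eps / 3 / 2) e c p.1 * keep_prob (eps / 3 / 2) e c p.2
     * (sgn R (c p.1) * sgn R (c p.2)))))); last by move=> c; field.
rewrite avgB avg_cst avgZ.
have [X0 X1] := edge_gap pE; have [_ Y1] := edge_gap pE'.
rewrite (eq_avg (_ : _ =1 (fun c =>
   keep_prob (eps / 3 / 2) e c p.1 * keep_prob (eps / 3 / 2) e c p.2
     * (sgn R (c p.1) * sgn R (c p.2))))) in Y1; last by move=> c; ring.
case: (boolP (high p.1)) => h1 /=; last by have := X1 h1; lra.
case: (boolP (high p.2)) => h2 /=; last by have := Y1 h2; lra.
by rewrite subrr mulr0 addr0; lra.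
Qed.

End LocalAlgorithm.

(** * Two lower bounds on the mean of a Gibbs distribution *)

Section Gibbs.
Variables (R : realType) (T : finType) (f : T -> R) (eta : R).
Hypothesis eta_ge0 : 0 <= eta.
Let w (t : T) : R := expR (eta * f t).

(* Chebyshev's sum inequality. *)
Lemma gibbs_mean_ge_avg : (\sum_t f t) * (\sum_t w t) <= #|T|%:R * \sum_t w t * f t.
Proof.
have : 0 <= \sum_(s : T) \sum_(t : T) (w s - w t) * (f s - f t).
  apply: sumr_ge0 => s _; apply: sumr_ge0 => t _.
  have [st|/ltW ts] := leP (f t) (f s).
    by rewrite mulr_ge0 ?subr_ge0// ler_expR ler_wpM2l.
  by rewrite mulr_le0 ?subr_le0// ler_expR ler_wpM2l.
rewrite (eq_bigr (fun s => #|T|%:R * (w s * f s) - w s * (\sum_t f t)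
  - (\sum_t w t) * f s + \sum_t w t * f t)).
  rewrite big_split !sumrB -!mulr_sumr -mulr_suml sumr_const -[_ *+ _]mulr_natl /=.
  by lra.
move=> s _.
rewrite (eq_bigr (fun t => w s * f s - w s * f t - w t * f s + w t * f t)).
  by rewrite big_split !sumrB sumr_const -mulr_sumr -mulr_suml -[w s * f s *+ _]mulr_natl.
by move=> t _; ring.
Qed.

(* Integrates y - k + 1 <= expR (y - k) at y = eta * (M - f t) against the
   Gibbs weights. *)
Lemma gibbs_mean_ge_max (A : {set T}) (M k : R) :
  {in A, forall t, f t = M} -> #|T|%:R <= expR k * #|A|%:R ->
  eta * M * (\sum_t w t) <= \sum_t w t * (eta * f t) + k * \sum_t w t.
Proof.
move=> fA TA.
have pointwise t : w t * (eta * (M - f t) - k + 1) <= expR (eta * M - k).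
  have -> : eta * M - k = eta * f t + (eta * (M - f t) - k) by ring.
  rewrite expRD ler_wpM2l ?expR_ge0// addrC; exact: expR_ge1Dx.
(* The maximizers alone bound the normalizing sum from below; with the hypothesis on [#|A|] it
   absorbs the constant [expR (eta * M - k)] summed over [T]. *)
have wA : expR (eta * M) * #|A|%:R <= \sum_t w t.
  rewrite mulr_natr -sumr_const [leRHS](bigID (mem A)) /=.
  rewrite ler_wpDr ?sumr_ge0// => [t _|]; first exact: expR_ge0.
  by apply: ler_sum => t tA; rewrite /w fA.
have : \sum_t w t * (eta * (M - f t) - k + 1) <= \sum_t w t.
  apply: le_trans (_ : \sum_(t : T) expR (eta * M - k) <= _).
    exact: ler_sum.
  rewrite sumr_const -[_ *+ _]mulr_natr; apply: le_trans wA.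
  rewrite expRD expRN -mulrA ler_wpM2l ?expR_ge0//.
  by rewrite ler_pdivrMl ?expR_gt0.
rewrite (eq_bigr (fun t => eta * M * w t - w t * (eta * f t) - k * w t + w t)); last first.
  by move=> t _; ring.
by rewrite big_split !sumrB -!mulr_sumr /=; lra.
Qed.

End Gibbs.

(** * The exponential mechanism on a fixed vertex set *)

Section ExponentialMechanism.
Variables (n : nat) (R : realType) (e : rel 'I_n) (eps : R).
Notation cut := {ffun 'I_n -> bool}.
Hypotheses (simple_e : simple_graph e) (eps_gt0 : 0 < eps).
Implicit Types (C D : {set 'I_n}) (S T : cut).

Definition inner_edges C : {set 'I_n * 'I_n} :=
  [set p in edges e | (p.1 \in C) && (p.2 \in C)].

(** Only these vertices influence [valIn], so the entropy loss is charged to them, and each has an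
    incident edge to pay for it. *)
Definition active C : {set 'I_n} := [set v in C | (0 < deg e v)%N].

(** As a weight on full cuts it leaves the spins outside [C] uniform, so it describes the whole of
    [S_1]. *)
Definition wt C S : R := expR (eps / 6 * (valIn e C S)%:R).

Lemma valInE C S :
  (valIn e C S)%:R = \sum_(p in inner_edges C) (S p.1 != S p.2)%:R :> R.
Proof.
rewrite /valIn card_mkset -sum1_card natr_sum big_mkcond [RHS]big_mkcond.
apply: eq_bigr => p _; rewrite !inE.
case: (p.1 < p.2)%N; case: (p.1 \in C); case: (p.2 \in C); case: (e _ _) => //=.
by case: (S p.1 != S p.2).
Qed.

Lemma deg_gt0 u v : e u v -> (0 < deg e u)%N /\ (0 < deg e v)%N.
Proof.
have [sym_e _] := simple_e.
by move=> uv; rewrite (card_nbrs simple_e uv) (card_nbrs simple_e (_ : e v u)) 1?sym_e.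
Qed.

Lemma valIn_active C S T : {in active C, S =1 T} ->
  (valIn e C S)%:R = (valIn e C T)%:R :> R.
Proof.
move=> ST; rewrite !valInE; apply: eq_bigr => p.
rewrite !inE => /andP[/andP[_ /deg_gt0[d1 d2]] /andP[p1 p2]].
by rewrite !ST ?inE ?p1 ?p2.
Qed.

Lemma depends_on_wt C : depends_on C (wt C).
Proof.
move=> S T ST; congr (expR (_ * _)); apply: valIn_active => v.
by rewrite inE => /andP[/ST].
Qed.

Lemma avg_agree D T : avg (fun S => [forall v in D, S v == T v]%:R) = (2 ^+ #|D|)^-1 :> R.
Proof.
rewrite (eq_avg (_ : _ =1
    (fun S => \prod_v (if v \in D then (S v == T v)%:R else 1)))); last first.
  move=> S; case: (boolP [forall v in D, S v == T v]) => [/forall_inP DS|].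
    by rewrite big1// => v _; case: ifP => // /DS ->.
  rewrite negb_forall_in => /exists_inP[v vD /negbTE SvT].
  by rewrite (bigD1 v)//= vD SvT mul0r.
rewrite (avg_prod_cut (fun v b => if v \in D then (b == T v)%:R else 1)).
rewrite (eq_bigr (fun v => if v \in D then 2^-1 else 1)).
  by rewrite -big_mkcond prodr_const exprVn.
move=> v _; case: ifP => _; last by field.
by case: (T v) => /=; field.
Qed.

(** Each cut of [C] has [2 ^+ (n - #|C|)] extensions of equal weight; formally, vanishing outside
    [C] is independent of the weight. *)
Lemma Zexp_full C : Zexp eps e C * 2 ^+ (n - #|C|) = \sum_(S : cut) wt C S.
Proof.
have -> : Zexp eps e C = \sum_(S : cut) [forall v in ~: C, S v == [ffun=> false] v]%:R * wt C S.
  rewrite /Zexp big_mkcond; apply: eq_bigr => S _.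
  under [in RHS]eq_forallb do rewrite ffunE.
  by case: ifP => _; rewrite ?mul0r// mul1r /wt; congr expR; field.
have := @avg_indep n R (~: C) C
  (fun S => [forall v in ~: C, S v == [ffun=> false] v]%:R) (wt C).
rewrite avg_agree => avgM.
have {avgM} : avg (fun S => [forall v in ~: C, S v == [ffun=> false] v]%:R * wt C S)
    = (2 ^+ #|~: C|)^-1 * avg (wt C).
  apply: avgM; [|move=> S T ST|exact: depends_on_wt].
    by apply/pred0P => v /=; rewrite inE andNb.
  by congr (nat_of_bool _)%:R; apply: eq_forallb_in => v /ST ->.
have -> : (n - #|C| = #|~: C|)%N by have := cardsC C; rewrite card_ord; lia.
rewrite /avg mulrCA => /(mulfI _) -> //.
  by rewrite mulrC mulVKf// expf_neq0.
Qed.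

Lemma sum_wt_gt0 C : 0 < \sum_(S : cut) wt C S.
Proof.
rewrite (bigD1 [ffun=> false])//= ltr_pwDl ?expR_gt0// sumr_ge0// => S _.
exact: expR_ge0.
Qed.

Lemma probS1E C S : probS1 eps e C S = wt C S / \sum_T wt C T.
Proof.
rewrite /probS1 -Zexp_full invfM mulrA; congr (_ / _ / _).
by rewrite /wt; congr expR; field.
Qed.

(** Flipping an endpoint outside [C] preserves the weight and exchanges cut and uncut. *)
Lemma cut_prob_outer C (p : 'I_n * 'I_n) : p \in edges e -> p \notin inner_edges C ->
  \sum_(S : cut) wt C S * (S p.1 != S p.2)%:R = 2^-1 * \sum_(S : cut) wt C S.
Proof.
move=> pE; rewrite [p \in inner_edges C]inE pE /= negb_and => pNC.
have p12 := edges_neq pE.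
have [x xNC xp] : exists2 x, x \notin C & x = p.1 \/ x = p.2.
  by case/orP: pNC => ?; [exists p.1 => //; left|exists p.2 => //; right].
have flipE S : (flip [set x] S p.1 != flip [set x] S p.2) = (S p.1 == S p.2).
  rewrite !ffunE !inE; case: xp => ->; rewrite eqxx.
    by rewrite [p.2 == _]eq_sym (negbTE p12); case: (S p.1); case: (S p.2).
  by rewrite (negbTE p12); case: (S p.1); case: (S p.2).
have wtE S : wt C (flip [set x] S) = wt C S.
  apply: depends_on_wt => v vC; rewrite ffunE inE.
  by rewrite (negbTE (_ : v != x)) ?addbF//; apply: contraNneq xNC => <-.
have flip_sum : \sum_(S : cut) wt C S * (S p.1 != S p.2)%:R =
    \sum_(S : cut) wt C S * (S p.1 == S p.2)%:R.
  rewrite -(sum_flip [set x]); apply: eq_bigr => S _.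
  by rewrite wtE flipE.
have : \sum_(S : cut) wt C S = \sum_(S : cut) wt C S * (S p.1 != S p.2)%:R +
                       \sum_(S : cut) wt C S * (S p.1 == S p.2)%:R.
  rewrite -big_split; apply: eq_bigr => S _ /=.
  by case: (S p.1 == S p.2); rewrite /= ?mulr0 ?mulr1 ?addr0 ?add0r.
by rewrite -flip_sum; lra.
Qed.

Lemma sum_cut_indicator (p : 'I_n * 'I_n) : p \in edges e ->
  \sum_(S : cut) (S p.1 != S p.2)%:R = 2^-1 * #|{: cut}|%:R :> R.
Proof.
move=> pE; have := @cut_prob_outer finset.set0 p pE.
have wt1 S : wt finset.set0 S = 1.
  rewrite /wt valInE big_pred0 ?mulr0 ?expR0// => q.
  by rewrite !inE /= andbF.
rewrite [p \in _]inE !inE /= andbF => /(_ isT).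
under eq_bigr do rewrite wt1 mul1r.
by under [in RHS]eq_bigr do rewrite wt1; rewrite sumr_const.
Qed.

Definition mean_S1 C : R := \sum_(S : cut) probS1 eps e C S * (Defs.val e S)%:R.

Lemma mean_S1E C : mean_S1 C =
  (\sum_(S : cut) wt C S * (valIn e C S)%:R) / (\sum_(S : cut) wt C S)
  + (#|edges e|%:R - #|inner_edges C|%:R) / 2.
Proof.
have Z0 := sum_wt_gt0 C; set Z := \sum_(S : cut) wt C S in Z0 *.
have cardE : #|edges e|%:R - #|inner_edges C|%:R =
    \sum_(p in edges e | p \notin inner_edges C) 1 :> R.
  rewrite -!sum1_card !natr_sum (bigID (mem (inner_edges C)) (mem (edges e))) /=.
  rewrite (eq_bigl (mem (inner_edges C))); first by rewrite addrC addrK.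
  by move=> p; rewrite /= [p \in inner_edges C]inE andbA andbb.
rewrite cardE.
transitivity ((\sum_(S : cut) wt C S * (valIn e C S)%:R +
  \sum_(S : cut) wt C S * \sum_(p in edges e | p \notin inner_edges C) (S p.1 != S p.2)%:R) / Z).
  rewrite -big_split mulr_suml; apply: eq_bigr => S _ /=.
  rewrite probS1E -/Z -mulrDr mulrAC; congr (_ * _ / _).
  rewrite valE valInE (bigID (mem (inner_edges C)) (mem (edges e))) /=; congr (_ + _).
  by apply: eq_bigl => p; rewrite /= [p \in inner_edges C]inE andbA andbb.
rewrite mulrDl; congr (_ + _).
under [X in X / _]eq_bigr do rewrite mulr_sumr.
rewrite exchange_big mulr_suml [RHS]mulr_suml; apply: eq_bigr => p /andP[pE pNC].
by rewrite cut_prob_outer// -/Z mulfK ?gt_eqF// mul1r.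
Qed.

Lemma sum_valIn C :
  \sum_(S : cut) (valIn e C S)%:R = #|{: cut}|%:R * (#|inner_edges C|%:R / 2) :> R.
Proof.
under eq_bigr do rewrite valInE.
rewrite exchange_big -sum1_card natr_sum mulr_suml mulr_sumr.
apply: eq_bigr => p; rewrite inE => /andP[pE _].
by rewrite sum_cut_indicator// mul1r mulrC.
Qed.

(** By Chebyshev, the Gibbs mean of [valIn] is at least its uniform mean, half of the inner
    edges. *)
Lemma mean_S1_ge_half C : #|edges e|%:R / 2 <= mean_S1 C.
Proof.
have eta0 : 0 <= eps / 6 by rewrite divr_ge0// ltW.
have := gibbs_mean_ge_avg (fun S => (valIn e C S)%:R) eta0.
rewrite sum_valIn -mulrA ler_pM2l; last first.
  by rewrite ltr0n; apply/card_gt0P; exists [ffun=> false].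
rewrite -ler_pdivlMr ?(sum_wt_gt0 C)// => H.
by rewrite mean_S1E; lra.
Qed.

(** With [k = #|active C|], the cuts agreeing with [S] on [active C] share its value and form a
    fraction [2 ^- k] of all cuts. Since [2 <= expR 1], [gibbs_mean_ge_max] applies, and dividing by
    [eps / 6] gives the loss. *)
Lemma mean_S1_ge_max C S :
  (valIn e C S)%:R - 6 * #|active C|%:R / eps
  + (#|edges e|%:R - #|inner_edges C|%:R) / 2 <= mean_S1 C.
Proof.
have e0 := eps_gt0.
pose A := [set T : cut | [forall v in active C, T v == S v]].
have fA : {in A, forall T, (valIn e C T)%:R = (valIn e C S)%:R :> R}.
  by move=> T; rewrite inE => /forall_inP TS; apply: valIn_active => v /TS/eqP.
have cardA : #|{: cut}|%:R <= expR (#|active C|%:R) * #|A|%:R :> R.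
  have := avg_agree (active C) S; rewrite /avg.
  have -> : \sum_(T : cut) [forall v in active C, T v == S v]%:R = #|A|%:R :> R.
    rewrite -sum1_card natr_sum [RHS]big_mkcond; apply: eq_bigr => T _.
    by rewrite inE; case: [forall v in _, _].
  rewrite card_ffun card_bool card_ord natrX => AE.
  have -> : #|A|%:R = 2 ^+ n * (2 ^+ #|active C|)^-1 :> R.
    by rewrite -AE mulrA mulfV ?mul1r// expf_neq0.
  rewrite mulrCA ler_peMr ?exprn_ge0//.
  rewrite ler_pdivlMr ?exprn_gt0// mul1r -[X in expR X]mulr1 expRM_natl.
  rewrite lerXn2r ?nnegrE ?expR_ge0//.
  by have := expR_ge1Dx (1 : R); lra.
have := @gibbs_mean_ge_max _ _ (fun T => (valIn e C T)%:R) (eps / 6) _ _ _ fA cardA.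
under [X in _ <= X + _]eq_bigr do rewrite mulrCA.
have Z0 := sum_wt_gt0 C.
rewrite -mulr_sumr mean_S1E lerD2r ler_pdivlMr// => H.
rewrite -(ler_pM2l (_ : 0 < eps / 6)); last by lra.
have -> : eps / 6 * (((valIn e C S)%:R - 6 * #|active C|%:R / eps) * \sum_(T : cut) wt C T) =
  eps / 6 * (valIn e C S)%:R * (\sum_(T : cut) wt C T) - #|active C|%:R * \sum_(T : cut) wt C T.
  by field; rewrite gt_eqF.
by rewrite lerBlDr.
Qed.

Lemma OPT_le_mean_S1 C :
  (OPT e)%:R / 2 + #|inner_edges C|%:R / 4 - 3 * #|active C|%:R / eps <= mean_S1 C.
Proof.
have [|S optS] := @boot.bigop.eq_bigmax {ffun 'I_n -> bool} (Defs.val e).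
  by apply/card_gt0P; exists [ffun=> false].
rewrite /OPT optS.
have H1 := mean_S1_ge_half C; have H2 := mean_S1_ge_max C S.
(* At worst, the optimal cut cuts every edge leaving or avoiding [C]; averaging [H1] and [H2] still
   leaves a quarter of the inner edges. *)
have H3 : (Defs.val e S)%:R <=
    (valIn e C S)%:R + (#|edges e|%:R - #|inner_edges C|%:R) :> R.
  rewrite -(sum1_card (mem (edges e))) -(sum1_card (mem (inner_edges C))) !natr_sum valE valInE.
  rewrite (bigID (mem (inner_edges C)) (mem (edges e))) /=.
  rewrite [X in _ + (X - _)](bigID (mem (inner_edges C)) (mem (edges e))) /=.
  have innerE (F : 'I_n * 'I_n -> R) : \sum_(p in edges e | p \in inner_edges C) F p =
      \sum_(p in inner_edges C) F p.
    by apply: eq_bigl => p; rewrite /= [p \in inner_edges C]inE andbA andbb.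
  rewrite !innerE lerD2l addrAC subrr add0r; apply: ler_sum => p _.
  by case: (S p.1 != S p.2).
have -> : 3 * #|active C|%:R / eps = (6 * #|active C|%:R / eps) / 2.
  by field; rewrite gt_eqF.
by lra.
Qed.

End ExponentialMechanism.

Lemma OPT_le_edges (n : nat) (e : rel 'I_n) : (OPT e <= #|edges e|)%N.
Proof.
apply/bigmax_leqP => S _; rewrite /Defs.val card_mkset; apply: subset_leq_card.
by apply/fintype.subsetP => p; rewrite !inE => /and3P[-> ->].
Qed.

(** * The random set of vertices of high noisy degree *)

Section RandomVertexSet.
Variables (n : nat) (R : realType) (e : rel 'I_n) (eps : R).
Hypotheses (simple_e : simple_graph e) (eps_gt0 : 0 < eps) (eps_le1 : eps <= 1).
Implicit Types (A C : {set 'I_n}).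
Notation p := (inC_prob eps e).

Let b_gt0 : 0 < 3 / eps. Proof. by rewrite divr_gt0. Qed.

Lemma inC_prob_ge0 v : 0 <= p v. Proof. exact: lap_tail_ge0. Qed.

Lemma inC_prob_le1 v : p v <= 1. Proof. exact: lap_tail_le1. Qed.

Lemma probC_ge0 C : 0 <= probC eps e C.
Proof.
apply: mulr_ge0; apply: prodr_ge0 => v _; first exact: inC_prob_ge0.
by rewrite subr_ge0 inC_prob_le1.
Qed.

(** Expanding the product of [p v + (1 - p v)] over all vertices, with the second term deleted on
    [A], leaves exactly the supersets of [A]. *)
Lemma probC_superset A :
  \sum_(C : {set 'I_n}) probC eps e C * (A \subset C)%:R = \prod_(v in A) p v.
Proof.
transitivity (\prod_v (p v + (if v \in A then 0 else 1 - p v))).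
  rewrite bigA_distr; apply: eq_big => [C|C _]; first by rewrite inE.
  rewrite /probC big_mkcond [X in _ * X * _]big_mkcond -big_split /=.
  have [AC|] := boolP (A \subset C).
    rewrite mulr1; apply: eq_bigr => v _; rewrite inE.
    have [vC|vNC] := boolP (v \in C); rewrite ?mulr1 ?mul1r//=.
    by rewrite ifN//; apply: contra vNC; exact: (fintype.subsetP AC).
  move=> /subsetPn[v vA vNC]; rewrite mulr0 (bigD1 v)//=.
  by rewrite (negbTE vNC) vA mul0r.
rewrite [RHS]big_mkcond; apply: eq_bigr => v _.
by case: ifP; rewrite ?addr0// addrC subrK.
Qed.

Lemma sum_probC : \sum_(C : {set 'I_n}) probC eps e C = 1.
Proof.
have := probC_superset finset.set0; rewrite big_set0 => <-.
by apply: eq_bigr => C _; rewrite finset.sub0set mulr1.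
Qed.

Lemma inC_prob_high v : high e eps v -> 2^-1 <= p v.
Proof.
rewrite /high /inC_prob; move: (10000 / _) => d dv.
by apply: (lap_tail_ge_half b_gt0); rewrite subr_le0 ltW.
Qed.

(** If [d >= 5000 / eps ^+ 2], the right side exceeds 1. Otherwise the tail starts beyond
    [5000 / eps ^+ 2], so it is at most [expR (- y)] with [y >= 1000 / eps], and
    [expR (- y) <= 1 / y]. *)
Lemma lap_tail_le_linear (k d : R) : 10000 <= k -> 1 <= d ->
  lap_tail (3 / eps) (k / eps ^+ 2 - d) <= eps / 1000 * d.
Proof.
move=> k_ge d1; have e0 := eps_gt0; have e1 := eps_le1.
rewrite -exprVn; set s := eps^-1.
have sE : eps * s = 1 by rewrite mulfV// gt_eqF.
have s1 : 1 <= s by rewrite invf_ge1.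
have ss : s <= s ^+ 2 by rewrite expr2 ler_peMr//; lra.
have ess : eps * s ^+ 2 = s by rewrite expr2 mulrA sE mul1r.
have kss : 10000 * s ^+ 2 <= k * s ^+ 2 by rewrite ler_wpM2r//; lra.
have [dl|dl] := leP (5000 * s ^+ 2) d.
  apply: le_trans (lap_tail_le1 b_gt0 _) _.
  by have := ler_wpM2l (ltW e0) dl; rewrite mulrCA ess; lra.
have a_ge : 5000 * s ^+ 2 <= k * s ^+ 2 - d by lra.
move: (k * s ^+ 2 - d) a_ge => a a_ge.
have a_ge0 : 0 <= a by lra.
rewrite lap_tailE// invf_div.
have y_ge : 1000 * s <= a * (eps / 3).
  by have := ler_wpM2l (ltW e0) a_ge; rewrite mulrCA ess; lra.
have yE : expR (- a * (eps / 3)) * (1000 * s) <= 1.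
  apply: le_trans (_ : expR (- a * (eps / 3)) * expR (a * (eps / 3)) <= _).
    rewrite ler_wpM2l ?expR_ge0//.
    by apply: le_trans y_ge _; apply: le_trans (expR_ge1Dx _); lra.
  by rewrite mulNr -expRD addNr expR0.
have E0 := expR_ge0 (- a * (eps / 3)).
have := ler_wpM2l (ltW e0) yE; move: (expR _) E0 => E E0.
rewrite (_ : eps * (E * (1000 * s)) = 1000 * E * (eps * s)); last by ring.
rewrite sE; have := ler_wpM2l (ltW e0) d1; lra.
Qed.

Lemma inC_prob_le_deg v : (0 < deg e v)%N -> p v <= eps / 1000 * (deg e v)%:R.
Proof. by move=> d0; apply: lap_tail_le_linear; rewrite ?lexx ?ler1n. Qed.

Lemma mean_card_active :
  \sum_(C : {set 'I_n}) probC eps e C * #|active e C|%:R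
  <= eps / 500 * #|edges e|%:R.
Proof.
have [sym_e irr_e] := simple_e.
have -> : \sum_(C : {set 'I_n}) probC eps e C * #|active e C|%:R =
    \sum_(v | (0 < deg e v)%N) p v.
  transitivity (\sum_(v | (0 < deg e v)%N) \prod_(w in [set v]) p w); last first.
    by apply: eq_bigr => v _; rewrite big_set1.
  under [RHS]eq_bigr do rewrite -probC_superset.
  rewrite exchange_big; apply: eq_bigr => C _; rewrite -mulr_sumr; congr (_ * _).
  rewrite -sum1_card natr_sum big_mkcond [RHS]big_mkcond; apply: eq_bigr => v _.
  by rewrite inE finset.sub1set; case: (v \in C); case: (0 < deg e v)%N.
(* The degree sum is twice the number of edges, which turns 1/1000 into 1/500. *)
have -> : eps / 500 * #|edges e|%:R = \sum_v eps / 1000 * (deg e v)%:R.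
  by rewrite -mulr_sumr -natr_sum sum_deg// natrM; field.
rewrite big_mkcond; apply: ler_sum => v _.
case: ifP => [|_]; first exact: inC_prob_le_deg.
by apply: mulr_ge0 (divr_ge0 (ltW eps_gt0) (ler0n _ _)) (ler0n _ _).
Qed.

(** The endpoints enter independently, each with probability at least 1/2 when [high]. *)
Lemma mean_card_inner :
  #|high_edges e eps|%:R / 4
  <= \sum_(C : {set 'I_n}) probC eps e C * #|inner_edges e C|%:R.
Proof.
have -> : \sum_(C : {set 'I_n}) probC eps e C * #|inner_edges e C|%:R =
    \sum_(q in edges e) p q.1 * p q.2.
  transitivity (\sum_(q in edges e) \prod_(v in [set q.1; q.2]) p v).
    under [RHS]eq_bigr do rewrite -probC_superset.
    rewrite exchange_big; apply: eq_bigr => C _; rewrite -mulr_sumr; congr (_ * _).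
    rewrite -sum1_card natr_sum big_mkcond [RHS]big_mkcond; apply: eq_bigr => q _.
    rewrite [q \in inner_edges e C]inE finset.subUset !finset.sub1set.
    by case: (q \in edges e) => //=; case: (_ && _).
  apply: eq_bigr => q /edges_neq q12.
  by rewrite big_setU1 ?inE//= big_set1.
rewrite -sum1_card natr_sum mulr_suml big_mkcond [leRHS]big_mkcond.
apply: ler_sum => q _; rewrite [q \in high_edges e eps]inE.
case: (q \in edges e) => //=.
case: (boolP (_ && _)) => [/andP[/inC_prob_high h1 /inC_prob_high h2]|_].
  by nra.
by rewrite mulr_ge0 ?inC_prob_ge0.
Qed.

(** Interpolates between the bound [OPT / 2] and that of [OPT_le_mean_S1], so that the loss, linear
    in the number of edges, can be scaled down to order [eps]. *)
Lemma expected_S1_ge (lambda : R) : 0 <= lambda <= 1 ->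
  (OPT e)%:R / 2
  + lambda * (#|high_edges e eps|%:R / 16 - #|edges e|%:R * 3 / 500)
  <= expected_S1 eps e.
Proof.
move=> /andP[l0 l1]; have e0 := eps_gt0.
have pointwise C : probC eps e C * ((OPT e)%:R / 2 +
    lambda * (#|inner_edges e C|%:R / 4 - 3 * #|active e C|%:R / eps))
    <= probC eps e C * mean_S1 e eps C.
  rewrite ler_wpM2l ?probC_ge0//.
  have H1 := OPT_le_mean_S1 simple_e eps_gt0 C.
  have H2 := mean_S1_ge_half simple_e eps_gt0 C.
  have H3 : (OPT e)%:R <= #|edges e|%:R :> R by rewrite ler_nat OPT_le_edges.
  have H4 : #|inner_edges e C|%:R / 4 - 3 * #|active e C|%:R / eps
      <= mean_S1 e eps C - (OPT e)%:R / 2 by lra.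
  have H5 : lambda * (mean_S1 e eps C - (OPT e)%:R / 2)
      <= mean_S1 e eps C - (OPT e)%:R / 2 by rewrite ler_piMl//; lra.
  by have := ler_wpM2l l0 H4; lra.
apply: (@le_trans _ _ (\sum_(C : {set 'I_n}) probC eps e C * ((OPT e)%:R / 2 +
    lambda * (#|inner_edges e C|%:R / 4 - 3 * #|active e C|%:R / eps)))); last first.
  by apply: ler_sum => C _; exact: pointwise.
rewrite (eq_bigr (fun C => probC eps e C * ((OPT e)%:R / 2)
  + lambda / 4 * (probC eps e C * #|inner_edges e C|%:R)
  - lambda * 3 / eps * (probC eps e C * #|active e C|%:R))); last first.
  by move=> C _; field; rewrite gt_eqF.
rewrite sumrB big_split /= -mulr_suml sum_probC -!mulr_sumr.
have H1 := ler_wpM2l (_ : 0 <= lambda / 4) mean_card_inner.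
have H2 := ler_wpM2l (_ : 0 <= lambda * 3 / eps) mean_card_active.
have {}H1 := H1 ltac:(by rewrite divr_ge0).
have {}H2 := H2 ltac:(by rewrite divr_ge0 ?mulr_ge0// ltW).
have E : lambda * 3 / eps * (eps / 500 * #|edges e|%:R) = lambda * (#|edges e|%:R * 3 / 500).
  by field; rewrite gt_eqF.
by rewrite E in H2; lra.
Qed.

End RandomVertexSet.

(** * Choice of constants and combination of the two gains *)

Theorem theorem5p7 (R : realType) :
  exists c0 c : R, 0 < c0 /\ 0 < c /\
    forall eps : R, 0 < eps -> eps <= c0 ->
    forall (n : nat) (e : rel 'I_n),
      simple_graph e -> triangle_free e ->
      (2^-1 + c * eps) * (OPT e)%:R <= expected_output eps e.
Proof.
have [c1 [c1_gt0 c1_le c1E]] : exists c1 : R,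
    [/\ 0 < c1, c1 <= 1 / 288 & expR (- 100) = 288 * c1].
  have E0 := expR_gt0 (- 100 : R).
  have E1 : expR (- 100) <= expR 0 :> R by rewrite ler_expR; lra.
  rewrite expR0 in E1.
  exists (expR (- 100) / 288); move: (expR _) E0 E1 => E E0 E1.
  by split; [lra|lra|field].
exists 1, (c1 / 4); split; first exact: ltr01.
split; first by lra.
move=> eps eps_gt0 eps_le1 n e simple_e triangle_free_e.
have OPTm : (OPT e)%:R <= #|edges e|%:R :> R by rewrite ler_nat OPT_le_edges.
have A_ge := expected_A_ge simple_e triangle_free_e eps_gt0 eps_le1.
have x_gt0 : 0 < c1 * eps by apply: mulr_gt0.
have x_le : c1 * eps <= 1 / 288.
  by apply: le_trans c1_le; rewrite ler_piMr// ltW.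
(* With [lambda = 16 * (c1 * eps)] the gain on [high_edges] cancels exactly the term missing from
   [A_ge]. *)
have l01 : 0 <= 16 * (c1 * eps) <= 1 by apply/andP; split; lra.
have S1_ge := expected_S1_ge simple_e eps_gt0 eps_le1 l01.
rewrite c1E (_ : eps * (288 * c1) / 288 = c1 * eps) in A_ge; last by field.
rewrite /expected_output (_ : c1 / 4 * eps = c1 * eps / 4); last by field.
move: (c1 * eps) x_gt0 A_ge S1_ge => x x_gt0 A_ge S1_ge.
have xOPTm := ler_wpM2l (ltW x_gt0) OPTm.
have xOPT : 0 <= x * (OPT e)%:R by apply: mulr_ge0 (ltW x_gt0) (ler0n _ _).
(* The remaining gain is [x * (1 - 48 / 500) / 2] per edge, at least the claimed [x / 4] per unit of
   [OPT]. *)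
by lra.
Qed.
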